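(* Let $p$ be an odd prime, $n$ a positive integer, and $g\in\mathbb{F}_{p^n}[x]$ a Dembowski-Ostrom polynomial. The following assertions are equivalent. (1) $g$ is (extended-affine) equivalent to $x^2\in\mathbb{F}_{p^n}[x]$. (2) All elements in $\mathcal{D}_g\setminus\{0\}$ are invertible, and $\mathcal{D}_gY^{-1}=\mathcal{D}_gZ^{-1}$ for all $Y,Z\in\mathcal{D}_g\setminus\{0\}$, and in particular $|\mathrm{Quot}(\mathcal{D}_g)|=p^n$. (3) The matrix $M_{g,1}$ is invertible, and the set $\mathcal{D}_gM_{g,1}^{-1}$ together with the addition and multiplication of matrices is a field isomorphic to $\mathbb{F}_{p^n}$.
   Context: A Dembowski-Ostrom (DO) polynomial in $\mathbb{F}_{p^n}[x]$ is one of the form $\sum_{0\le i\le j\le n-1}u_{i,j}x^{p^i+p^j}$ with $u_{i,j}\in\mathbb{F}_{p^n}$. A linearized polynomial is one of the form $\sum_i u_ix^{p^i}$, $u_i\in\mathbb{F}_{p^n}$; it is a linearized permutation polynomial if its evaluation map on $\mathbb{F}_{p^n}$ is bijective. Fix an $\mathbb{F}_p$-basis of $\mathbb{F}_{p^n}$, so that each linearized polynomial is associated with the $n\times n$ matrix over $\mathbb{F}_p$ of the $\mathbb{F}_p$-linear map it induces. For a DO polynomial $g$ and $\alpha\in\mathbb{F}_{p^n}$, $\Delta_{g,\alpha}(x)=g(x+\alpha)-g(x)-g(\alpha)$ is a linearized polynomial; $M_{g,\alpha}$ denotes its associated matrix, and $\mathcal{D}_g=\{M_{g,\alpha}\mid\alpha\in\mathbb{F}_{p^n}\}$.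 For invertible $Y$, $\mathcal{D}_gY^{-1}=\{XY^{-1}\mid X\in\mathcal{D}_g\}$. The set of quotients is $\mathrm{Quot}(\mathcal{D}_g)=\{XY^{-1}\mid X,Y\in\mathcal{D}_g,\ Y\text{ invertible}\}$. Two polynomials $g,g'\in\mathbb{F}_{p^n}[x]/(x^{p^n}-x)$ are (extended-affine) equivalent if there exist linearized permutation polynomials $L,L'$, a linearized polynomial $L''$, and $u,v,w\in\mathbb{F}_{p^n}$ with $g'(x)=L'(g(L(x)+u))+v+L''(x)+w \bmod (x^{p^n}-x)$.
   Formalization: In (2), |Quot(D_g)| = p^n is a condition in its own right, not a consequence of the other two: for g = 0 those hold vacuously (D_g = {0}, Quot empty) while (1) and (3) fail; for nonzero g it follows from them. *)

(* Defs.v *)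
From HB Require Import structures.
From mathcomp Require Import all_boot all_order all_algebra all_field.

Set Implicit Arguments.
Unset Strict Implicit.
Unset Printing Implicit Defensive.

Import GRing.Theory.
Local Open Scope ring_scope.

(* The field with p ^ n elements is an extension F of 'F_p of degree n;
   [finvect_type F] is F itself, equipped with its finType structure. *)

Section DembowskiOstrom.

Variables (p n : nat) (F : fieldExtType 'F_p).

Definition DO_polynomial (g : {poly F}) : Prop :=
  exists u : 'I_n -> 'I_n -> F,
    g = \sum_(i < n) \sum_(j < n | (i <= j)%N) u i j *: 'X^(p ^ i + p ^ j)%N.

Definition linearized (L : {poly F}) : Prop :=
  exists (m : nat) (u : 'I_m -> F), L = \sum_(i < m) u i *: 'X^(p ^ i)%N.

Definition linearized_permutation (L : {poly F}) : Prop :=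
  linearized L /\ bijective (fun x : F => L.[x]).

(* Classes modulo 'X^(p ^ n) - 'X are given by arbitrary representatives. *)
Definition EA_equivalent (g g' : {poly F}) : Prop :=
  exists L L' L'' : {poly F}, exists u v w : F,
    [/\ linearized_permutation L, linearized_permutation L', linearized L''
      & g' %% ('X^(p ^ n) - 'X)
        = (L' \Po (g \Po (L + u%:P)) + v%:P + L'' + w%:P) %% ('X^(p ^ n) - 'X)].

Definition Delta (g : {poly F}) (a : F) : {poly F} :=
  g \Po ('X + a%:P) - g - (g.[a])%:P.

(* Matrices act on column vectors: column j holds the coordinates of L(e_j), so
   the product of matrices corresponds to the composition of maps (unlike the
   row-vector convention of [mxof]). *)
Definition assoc_mx (e : n.-tuple F) (L : {poly F}) : 'M['F_p]_n :=
  \matrix_(i, j) coord e i L.[e`_j].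

Definition M_ (e : n.-tuple F) (g : {poly F}) (a : F) : 'M['F_p]_n :=
  assoc_mx e (Delta g a).

Definition D_ (e : n.-tuple F) (g : {poly F}) : {set 'M['F_p]_n} :=
  [set M_ e g a | a : finvect_type F].

Definition rdiv_set (D : {set 'M['F_p]_n}) (Y : 'M['F_p]_n) :
    {set 'M['F_p]_n} :=
  [set X *m invmx Y | X in D].

Definition Quot (D : {set 'M['F_p]_n}) : {set 'M['F_p]_n} :=
  [set X *m invmx Y | X in D, Y in D & Y \in unitmx].

(* Associativity and distributivity are inherited from the matrix ring; the
   multiplicative identity of S is not required to be 1%:M. *)
Definition mx_field (S : {set 'M['F_p]_n}) : Prop :=
  [/\ zmod_closed S,
      {in S &, forall A B, A *m B \in S},
      {in S &, forall A B, A *m B = B *m A}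
    & exists I : 'M['F_p]_n,
        [/\ I \in S, I != 0, {in S, forall A, I *m A = A}
          & {in S, forall A, A != 0 -> exists2 B, B \in S & A *m B = I}]].

Definition mx_isomorphic (S : {set 'M['F_p]_n}) : Prop :=
  exists phi : F -> 'M['F_p]_n,
    [/\ {morph phi : x y / x + y}, {morph phi : x y / x * y >-> x *m y},
        injective phi & forall A, A \in S <-> exists x, phi x = A].

End DembowskiOstrom.

(* Main.v *)
Require Import Defs.
From HB Require Import structures.
From mathcomp Require Import all_boot all_order all_algebra all_fingroup.
From mathcomp Require Import all_solvable all_field ring.

Set Implicit Arguments.
Unset Strict Implicit.
Unset Printing Implicit Defensive.

Import GRing.Theory.
Local Open Scope ring_scope.

(** Let B(x, y) = g(x + y) - g(x) - g(y); it is symmetric, biadditive and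
    B(x, x) = 2 g(x).  Everything passes through the form
    B(x, y) = lam (sig x * sig y) with lam and sig additive bijections of F.
    Polarizing an equivalence with x^2 yields it, and conversely it turns g
    into x^2 because every additive map is linearized (a Moore matrix is
    invertible).  In this form the matrices A_x = M_x M_1^-1 are those of the
    maps lam o (multiplication by sig x / sig 1) o lam^-1, a copy of F.
    If all the quotient sets coincide, K = D M_1^-1 is closed under products,
    and the symmetry of B makes it commutative: A_x A_y and A_y A_x agree at
    B(1, 1), and a nonzero element of K is invertible.  Each A in K satisfies
    A^(p^n) = A, so K is simultaneously diagonalizable over F, and reading off
    one common eigenvalue is an isomorphism from K onto F. *)

(** * Commutative fields of matrices over the prime field *)

Lemma card_fieldExt (p n : nat) (F : fieldExtType 'F_p) :
  prime p -> \dim {:F} = n -> #|finvect_type F| = (p ^ n)%N.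
Proof.
move=> p_pr dimF; rewrite -(card_vspacef (Vector.class (finvect_type F))).
by rewrite card_vspace card_Fp // -dimF.
Qed.

Lemma prod_XsubC_fieldExt (p n : nat) (F : fieldExtType 'F_p) :
  prime p -> \dim {:F} = n ->
  \prod_(x <- enum (finvect_type F)) ('X - (x : F)%:P) = 'X^(p ^ n) - 'X.
Proof.
move=> p_pr dimF; rewrite -(card_fieldExt p_pr dimF).
have := finField_genPoly (finvect_type F).
by rewrite -big_enum => ->.
Qed.

(** The nonzero elements of [K] form a subgroup of the general linear group of order [#|K| - 1]: in
    a finite group, closure under products suffices. The order of [A] divides this number. *)
Lemma mx_expr_card (p n : nat) (K : {set 'M['F_p]_n.+1}) :
    0 \in K -> 1 \in K -> {in K &, forall A B, A *m B \in K} ->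
    {in K, forall A, A != 0 -> A \in unitmx} ->
  {in K, forall A, A ^+ #|K| = A}.
Proof.
move=> K0 K1 KM Kunit A KA.
have [->|A0] := eqVneq A 0.
  by rewrite expr0n (cardD1 0) K0.
pose G := [set u : {'GL_n.+1[ 'F_p]} | GLval u \in K].
have gG : group_set G.
  apply/group_setP; split; first by rewrite inE.
  by move=> u v; rewrite !inE => Ku Kv; rewrite GL_ME KM.
have GK : [set GLval u | u in G] = K :\ 0.
  apply/setP => B; rewrite in_setD1; apply/imsetP/andP => [[u Gu ->]|[B0 KB]].
    rewrite inE in Gu; split=> //.
    by apply: contraTneq (GL_unit u) => ->; rewrite unitr0.
  by exists (Sub B (Kunit _ KB B0)); rewrite ?inE SubK.
have cG : #|G| = #|K|.-1.
  rewrite (cardsD1 0 K) K0 -GK card_imset //; exact: val_inj.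
pose u : {'GL_n.+1[ 'F_p]} := Sub A (Kunit _ KA A0).
have uG : u \in Group gG by rewrite inE SubK.
have /(congr1 GLval) := expg_cardG uG; rewrite -[#|_|]/#|G|.
have GLX m : GLval (u ^+ m)%g = A ^+ m.
  by elim: m => [|m IHm] //; rewrite expgS exprS GL_ME IHm SubK.
rewrite GLX GL_1E cG => AG1.
have -> : #|K| = #|K|.-1.+1 by rewrite (cardD1 0) K0.
by rewrite exprSr AG1 mul1r.
Qed.

(** Each [A] in [K] is a root of ['X^(p ^ n.+1) - 'X], which splits over [F] with distinct roots, so
    [A] is diagonalizable over [F]. Commuting diagonalizable matrices are simultaneously
    diagonalizable. *)
Lemma codiag_mx_field (p n : nat) (F : fieldExtType 'F_p)
    (K : {set 'M['F_p]_n.+1}) :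
  prime p -> \dim {:F} = n.+1 -> #|K| = (p ^ n.+1)%N ->
  0 \in K -> 1 \in K -> {in K &, forall A B, A *m B \in K} ->
  {in K &, forall A B, A *m B = B *m A} ->
  {in K, forall A, A != 0 -> A \in unitmx} ->
  exists2 P : 'M[F]_n.+1, P \in unitmx
    & {in K, forall A, exists d,
         P *m map_mx (in_alg F) A *m invmx P = diag_mx d}.
Proof.
move=> p_pr dimF cK K0 K1 KM KC Kunit.
pose As := [seq map_mx (in_alg F) A | A <- enum K].
have [|P P_unit /allP diagP] := (codiagonalizableP As).1.
  split=> [_ _ /mapP[A KA ->] /mapP[B KB ->]|_ /mapP[A KA ->]].
    by rewrite /comm_mx -!map_mxM KC // -mem_enum.
  rewrite mem_enum in KA; apply/diagonalizableP.
  exists (enum (finvect_type F)); first exact: enum_uniq.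
  rewrite (prod_XsubC_fieldExt p_pr dimF).
  apply/mxminpoly_minP; rewrite rmorphB rmorphXn /= horner_mx_X.
  by rewrite -rmorphXn -cK (mx_expr_card K0 K1 KM Kunit KA) subrr.
exists P => // A KA.
have /diagP /similar_diagPex[d /(similarP P_unit) PA] :
    map_mx (in_alg F) A \in As by apply: map_f; rewrite mem_enum.
by exists d; rewrite PA mulmxK.
Qed.

Lemma mx_field_isomorphic (p n : nat) (F : fieldExtType 'F_p)
    (K : {set 'M['F_p]_n.+1}) :
  prime p -> \dim {:F} = n.+1 -> #|K| = (p ^ n.+1)%N ->
  zmod_closed K -> 1 \in K -> {in K &, forall A B, A *m B \in K} ->
  {in K &, forall A B, A *m B = B *m A} ->
  {in K, forall A, A != 0 -> A \in unitmx} ->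
  mx_isomorphic F K.
Proof.
move=> p_pr dimF cK [K0 KB] K1 KM KC Kunit.
have [P P_unit diagP] := codiag_mx_field p_pr dimF cK K0 K1 KM KC Kunit.
pose T A := P *m map_mx (in_alg F) A *m invmx P.
(* [chi A] is the eigenvalue of [A] on the first common eigenvector. The type [finvect_type F] makes
   the counting argument for surjectivity available. *)
pose chi A : finvect_type F := T A 0 0.
have TM A B : T (A *m B) = T A *m T B.
  by rewrite /T map_mxM !mulmxA mulmxKV.
have TB A B : T (A - B) = T A - T B by rewrite /T map_mxB mulmxBr mulmxBl.
have chiB A B : chi (A - B) = chi A - chi B by rewrite /chi TB !mxE.
have chiM A B : A \in K -> chi (A *m B) = chi A * chi B.
  rewrite /chi TM => /diagP[d]; rewrite -/(T A) => ->.
  by rewrite mul_diag_mx !mxE mulr1n.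
have chi1 : chi 1 = 1 by rewrite /chi /T map_mx1 mulmx1 mulmxV // mxE.
(* Otherwise [A] is invertible, and [1 = chi A * chi (invmx A) = 0]. *)
have chi0 A : A \in K -> chi A = 0 -> A = 0.
  move=> KA chiA; apply/eqP/negP => /negP /(Kunit _ KA) A_unit.
  have /eqP := chiM A (invmx A) KA.
  by rewrite mulmxV // -[1%:M]/(1 : 'M_n.+1) chi1 chiA mul0r oner_eq0.
have chi_inj : {in K &, injective chi}.
  move=> A B KA KB' eq_chi; apply/eqP; rewrite -subr_eq0.
  by apply/eqP/chi0; rewrite ?KB // chiB eq_chi subrr.
have chi_surj x : exists2 A, A \in K & chi A = x.
  have /setP/(_ x) : [set chi A | A in K] = setT.
    apply/eqP; rewrite eqEcard subsetT cardsT card_in_imset //.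
    by rewrite cK (card_fieldExt p_pr dimF) leqnn.
  by rewrite inE => /imsetP[A KA ->]; exists A.
(* [phi] is the inverse of [chi] on [K]; the default [0] is never reached, as [chi] maps [K] onto
   [F]. *)
pose phi x := odflt 0 [pick A in K | chi A == x].
have phiP x : phi x \in K /\ chi (phi x) = x.
  rewrite /phi; case: pickP => [A /andP[KA /eqP]|] //=.
  by have [A KA chiA] := chi_surj x; move/(_ A); rewrite KA chiA eqxx.
have KN A : A \in K -> - A \in K by move=> KA; rewrite -sub0r KB.
have KD A B : A \in K -> B \in K -> A + B \in K.
  by move=> KA KB'; rewrite -[B]opprK KB // KN.
have chiD A B : chi (A + B) = chi A + chi B.
  by rewrite -{2}[A](addrK B) chiB subrK.
have phiK A : A \in K -> phi (chi A) = A.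
  by move=> KA; apply: chi_inj => //; case: (phiP (chi A)).
exists phi; split=> [x y|x y|x y eq_xy|A].
- have [[Kx <-] [Ky <-]] := (phiP x, phiP y).
  by rewrite -chiD !phiK ?KD.
- have [[Kx <-] [Ky <-]] := (phiP x, phiP y).
  by rewrite -chiM // !phiK ?KM.
- by have [[_ <-] [_ <-]] := (phiP x, phiP y); rewrite eq_xy.
split=> [KA|[x <-]]; first by exists (chi A); rewrite phiK.
by case: (phiP x).
Qed.

(** * Additive maps and linearized polynomials *)

Lemma inj_bij_fieldExt (p : nat) (F : fieldExtType 'F_p) (f : F -> F) :
  injective f -> bijective f.
Proof. exact: (@injF_bij (finvect_type F)). Qed.

Lemma can_morphD (V W : zmodType) (f : V -> W) (f' : W -> V) :
  {morph f : x y / x + y} -> cancel f f' -> cancel f' f ->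
  {morph f' : x y / x + y}.
Proof. by move=> fD fK f'K x y; rewrite -{1}[x]f'K -{1}[y]f'K -fD fK. Qed.

Lemma morphD0 (V W : zmodType) (f : V -> W) :
  {morph f : x y / x + y} -> f 0 = 0.
Proof. by move=> fD; apply: (addIr (f 0)); rewrite -fD !add0r. Qed.

Lemma morphDB (V W : zmodType) (f : V -> W) :
  {morph f : x y / x + y} -> {morph f : x y / x - y}.
Proof. by move=> fD x y; apply: (addIr (f y)); rewrite -fD !subrK. Qed.

Lemma morphD_sum (V W : zmodType) (f : V -> W) (I : Type) (r : seq I)
    (E : I -> V) :
  {morph f : x y / x + y} -> f (\sum_(i <- r) E i) = \sum_(i <- r) f (E i).
Proof. by move=> fD; apply: (big_morph f fD (morphD0 fD)). Qed.

(** A scalar of ['F_p] acts as a natural number multiple, so additivity alone gives linearity. *)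
Lemma morphD_scale (p : nat) (V W : lmodType 'F_p) (f : V -> W) :
  {morph f : x y / x + y} -> forall k x, f (k *: x) = k *: f x.
Proof.
move=> fD k x; rewrite -[k]natr_Zp !scaler_nat.
by elim: (k : nat) => [|m IHm]; rewrite ?mulr0n ?morphD0 // !mulrS fD IHm.
Qed.

Lemma pchar_fieldExt (p : nat) (F : fieldExtType 'F_p) :
  prime p -> p \in [pchar F].
Proof. by move=> p_pr; rewrite (pchar_lalg F) pchar_Fp. Qed.

Lemma expr_pexpD (p : nat) (F : fieldExtType 'F_p) (i : nat) :
  prime p -> {morph (fun x : F => x ^+ (p ^ i)) : x y / x + y}.
Proof.
move=> p_pr x y; apply: exprDn_pchar.
by rewrite pnatX pnatE // pchar_fieldExt.
Qed.

Lemma horner_linearized (p m : nat) (F : fieldExtType 'F_p) (u : 'I_m -> F) x :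
  (\sum_(i < m) u i *: 'X^(p ^ i)).[x] = \sum_(i < m) u i * x ^+ (p ^ i).
Proof.
by rewrite horner_sum; apply: eq_bigr => i _; rewrite hornerZ hornerXn.
Qed.

Lemma linearizedD (p : nat) (F : fieldExtType 'F_p) (L : {poly F}) :
  prime p -> linearized L -> {morph horner L : x y / x + y}.
Proof.
move=> p_pr [m [u ->]] x y; rewrite !horner_linearized -big_split /=.
by apply: eq_bigr => i _; rewrite expr_pexpD // mulrDr.
Qed.

(** The polynomial has degree less than [p ^ n] but vanishes at all [p ^ n] elements of [F], so it
    is zero; its exponents [p ^ i] are distinct. *)
Lemma linearized_eq0 (p n : nat) (F : fieldExtType 'F_p) (u : 'I_n -> F) :
  prime p -> \dim {:F} = n ->
  (forall x, \sum_(i < n) u i * x ^+ (p ^ i) = 0) -> forall i, u i = 0.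
Proof.
move=> p_pr dimF u0 i.
pose L := \sum_(i < n) u i *: 'X^(p ^ i).
have sizeL : (size L <= p ^ n)%N.
  apply: (leq_trans (size_sum _ _ _)); apply/bigmax_leqP => j _.
  apply: (leq_trans (size_scale_leq _ _)).
  by rewrite size_polyXn ltn_exp2l ?prime_gt1.
have L0 : L = 0.
  apply/eqP; apply: contraTT sizeL => L_neq0; rewrite -ltnNge.
  rewrite -(card_fieldExt p_pr dimF) cardE.
  apply: max_poly_roots (enum_uniq _) => //.
  by apply/allP => x _; rewrite /root horner_linearized u0.
have /(congr1 (fun q : {poly F} => q`_(p ^ i))) := L0.
rewrite coef0 coef_sum (bigD1 i) //= big1 => [|j ji].
  by rewrite coefZ coefXn eqxx mulr1 addr0.
rewrite coefZ coefXn eqn_exp2l ?prime_gt1 // eq_sym.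
by rewrite (inj_eq val_inj) (negPf ji) mulr0.
Qed.

(** The coefficients solve a linear system prescribing the values of [f] on the basis. Its Moore
    matrix [E] is invertible: a vector in the left kernel gives a linearized polynomial that
    vanishes on the basis, hence everywhere, so its coefficients are zero. *)
Lemma additive_linearized (p n : nat) (F : fieldExtType 'F_p)
    (e : n.-tuple F) (f : F -> F) :
  prime p -> \dim {:F} = n -> basis_of {:F} e ->
  {morph f : x y / x + y} -> exists2 L, linearized L & horner L =1 f.
Proof.
move=> p_pr dimF e_basis fD.
have eE x : x = \sum_i coord e i x *: e`_i by apply: coord_basis (memvf x).
pose E : 'M[F]_n := \matrix_(i, j) e`_j ^+ (p ^ i).
have E_free : row_free E.
  apply/inj_row_free => v vE0; apply/rowP => i; rewrite mxE.
  apply: (linearized_eq0 p_pr dimF) i => x.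
  pose L := \sum_(i < n) v 0 i *: 'X^(p ^ i).
  have LD : {morph horner L : x y / x + y}.
    by apply: linearizedD => //; exists n, (v 0).
  rewrite -horner_linearized -/L [x]eE morphD_sum // big1 // => j _.
  rewrite morphD_scale // horner_linearized.
  have /rowP/(_ j) := vE0; rewrite !mxE => vE0j.
  rewrite (eq_bigr (fun k => v 0 k * E k j)) ?vE0j ?scaler0 // => k _.
  by rewrite mxE.
pose u := (\row_j f e`_j) *m invmx E.
pose L := \sum_(i < n) u 0 i *: 'X^(p ^ i).
have L_lin : linearized L by exists n, (u 0).
exists L => // x; have LD := linearizedD p_pr L_lin.
rewrite [x]eE !morphD_sum //; apply: eq_bigr => j _.
rewrite !morphD_scale //; congr (_ *: _).
have /rowP/(_ j) : u *m E = \row_j f e`_j by rewrite mulmxKV // -row_free_unit.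
rewrite !mxE horner_linearized => <-.
by apply: eq_bigr => k _; rewrite !mxE.
Qed.

(** The modulus is the product of the distinct factors ['X - x] for [x] in [F], so it divides
    [P - Q] exactly when all values of [P - Q] vanish. *)
Lemma eqp_modXq (p n : nat) (F : fieldExtType 'F_p) (P Q : {poly F}) :
  prime p -> \dim {:F} = n ->
  P %% ('X^(p ^ n) - 'X) = Q %% ('X^(p ^ n) - 'X) <-> horner P =1 horner Q.
Proof.
move=> p_pr dimF; rewrite -(prod_XsubC_fieldExt p_pr dimF).
set G := \prod_(x <- _) _; have rootG x : root G x.
  by rewrite root_prod_XsubC (mem_enum (finvect_type F)).
split=> [eq_mod x|eqPQ].
  rewrite (divp_eq P G) (divp_eq Q G) eq_mod !hornerD !hornerM.
  by rewrite (eqP (rootG x)) !mulr0.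
apply/eqP; rewrite -subr_eq0 -modpN -modpD; apply/eqP/modp_eq0P.
apply: uniq_roots_dvdp; last first.
  by rewrite uniq_rootsE; apply: (enum_uniq (finvect_type F)).
by apply/allP => x _; rewrite /root hornerD hornerN eqPQ subrr.
Qed.

(** * Polarization of a Dembowski-Ostrom polynomial *)

Definition polar (R : nzRingType) (g : {poly R}) (x y : R) : R :=
  g.[x + y] - g.[x] - g.[y].

Lemma polarC (R : nzRingType) (g : {poly R}) x y : polar g x y = polar g y x.
Proof. by rewrite /polar [x + y]addrC addrAC. Qed.

Lemma horner_Delta (p : nat) (F : fieldExtType 'F_p) (g : {poly F}) a x :
  (Delta g a).[x] = polar g x a.
Proof. by rewrite !hornerE horner_comp !hornerE. Qed.

Section DOPolynomial.

Variables (p n : nat) (F : fieldExtType 'F_p) (g : {poly F}).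
Hypotheses (p_pr : prime p) (gDO : DO_polynomial n g).

Lemma polar_DO : exists u : 'I_n -> 'I_n -> F,
  (forall x, g.[x] = \sum_(i < n) \sum_(j < n | (i <= j)%N)
                u i j * (x ^+ (p ^ i) * x ^+ (p ^ j))) /\
  (forall x y, polar g x y = \sum_(i < n) \sum_(j < n | (i <= j)%N)
    u i j * (x ^+ (p ^ i) * y ^+ (p ^ j) + y ^+ (p ^ i) * x ^+ (p ^ j))).
Proof.
have [u gE] := gDO; exists u.
have gxE x : g.[x] = \sum_(i < n) \sum_(j < n | (i <= j)%N)
                u i j * (x ^+ (p ^ i) * x ^+ (p ^ j)).
  rewrite gE horner_sum; apply: eq_bigr => i _; rewrite horner_sum.
  by apply: eq_bigr => j _; rewrite hornerZ hornerXn exprD.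
split=> // x y; rewrite /polar !gxE -!sumrB; apply: eq_bigr => i _.
rewrite -!sumrB; apply: eq_bigr => j _; rewrite !expr_pexpD //; ring.
Qed.

Lemma polarDl y : {morph polar g ^~ y : x x' / x + x'}.
Proof.
move=> x x' /=; have [u [_ BE]] := polar_DO; rewrite !BE -big_split /=.
apply: eq_bigr => i _; rewrite -big_split /=; apply: eq_bigr => j _.
by rewrite !expr_pexpD //; ring.
Qed.

Lemma polarDr x : {morph polar g x : y y' / y + y'}.
Proof. by move=> y y'; rewrite !(polarC g x) polarDl. Qed.

Lemma polar_diag x : polar g x x = g.[x] *+ 2.
Proof.
have [u [gE BE]] := polar_DO; rewrite BE gE -sumrMnl.
apply: eq_bigr => i _; rewrite -sumrMnl; apply: eq_bigr => j _; ring.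
Qed.

End DOPolynomial.

(** * Matrices of additive maps in a basis *)

Section MatrixOfAdditive.

Variables (p n : nat) (F : fieldExtType 'F_p) (e : n.-tuple F).
Hypothesis e_basis : basis_of {:F} e.

Definition coord_cv (x : F) : 'cV['F_p]_n := \col_i coord e i x.

Definition mx_of (f : F -> F) : 'M['F_p]_n :=
  \matrix_(i, j) coord e i (f e`_j).

Lemma basis_sum x : x = \sum_i coord e i x *: e`_i.
Proof. exact: coord_basis (memvf x). Qed.

Lemma coord_cvD : {morph coord_cv : x y / x + y}.
Proof. by move=> x y; apply/colP => i; rewrite !mxE linearD. Qed.

Lemma coord_cv_inj : injective coord_cv.
Proof.
move=> x y /colP eq_xy; rewrite [x]basis_sum [y]basis_sum.
by apply: eq_bigr => i _; have := eq_xy i; rewrite !mxE => ->.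
Qed.

Lemma coord_cv_surj v : exists x, coord_cv x = v.
Proof.
exists (\sum_i v i 0 *: e`_i); apply/colP => i.
by rewrite mxE coord_sum_free ?(basis_free e_basis).
Qed.

Lemma mx_of_cv f : {morph f : x y / x + y} ->
  forall x, mx_of f *m coord_cv x = coord_cv (f x).
Proof.
move=> fD x; apply/colP => i; rewrite !mxE [in RHS](basis_sum x).
rewrite morphD_sum // linear_sum; apply: eq_bigr => j _.
by rewrite !mxE morphD_scale // linearZ mulrC.
Qed.

Lemma mx_ext (A B : 'M['F_p]_n) :
  (forall x, A *m coord_cv x = B *m coord_cv x) -> A = B.
Proof.
move=> eqAB; apply/matrixP => i j.
have [x x_j] := coord_cv_surj (delta_mx j 0).
by have /colP/(_ i) := eqAB x; rewrite x_j -!colE !mxE.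
Qed.

Lemma mx_of_mul f f' : {morph f : x y / x + y} -> {morph f' : x y / x + y} ->
  mx_of f *m mx_of f' = mx_of (f \o f').
Proof.
move=> fD f'D; apply: mx_ext => x; rewrite -mulmxA !mx_of_cv //.
by move=> y z /=; rewrite f'D fD.
Qed.

Lemma mx_of_unit f : {morph f : x y / x + y} -> bijective f ->
  mx_of f \in unitmx.
Proof.
move=> fD [f' fK f'K]; have f'D := can_morphD fD fK f'K.
have ff' : mx_of f *m mx_of f' = 1%:M; last exact: (proj1 (mulmx1_unit ff')).
rewrite mx_of_mul //; apply: mx_ext => x; rewrite mul1mx mx_of_cv /= ?f'K //.
by move=> y z; rewrite /= f'D fD.
Qed.

End MatrixOfAdditive.

(** * Copies of the field among matrices, and sets of quotients *)

Lemma mx_isomorphic_mx_field (p n : nat) (F : fieldExtType 'F_p)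
    (S : {set 'M['F_p]_n}) :
  mx_isomorphic F S -> mx_field S.
Proof.
move=> [phi [phiD phiM phi_inj S_phi]].
have phi0 := morphD0 phiD.
split; first split.
- by apply/S_phi; exists 0.
- move=> _ _ /S_phi[x <-] /S_phi[y <-]; apply/S_phi; exists (x - y).
  exact: morphDB.
- by move=> _ _ /S_phi[x <-] /S_phi[y <-]; apply/S_phi; exists (x * y).
- by move=> _ _ /S_phi[x <-] /S_phi[y <-]; rewrite -!phiM mulrC.
exists (phi 1); split=> [|||_ /S_phi[x <-]].
- by apply/S_phi; exists 1.
- by rewrite -phi0 (inj_eq phi_inj) oner_eq0.
- by move=> _ /S_phi[x <-]; rewrite -phiM mul1r.
rewrite -phi0 (inj_eq phi_inj) => x_neq0.
exists (phi x^-1); first by apply/S_phi; exists x^-1.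
by rewrite -phiM divff.
Qed.

(** Multiplicativity alone does not make [phi] unital. If [phi x] is the identity matrix, then
    [phi 1 = phi 1 *m phi x = phi x]. *)
Lemma mx_morph1 (R S : nzRingType) (n : nat) (phi : R -> 'M[S]_n) :
  {morph phi : x y / x * y >-> x *m y} -> (exists x, phi x = 1%:M) ->
  phi 1 = 1%:M.
Proof. by move=> phiM [x phix]; rewrite -[LHS]mulmx1 -phix -phiM mul1r. Qed.

Lemma card_mx_isomorphic (p n : nat) (F : fieldExtType 'F_p)
    (S : {set 'M['F_p]_n}) :
  mx_isomorphic F S -> #|S| = #|finvect_type F|.
Proof.
move=> [phi [_ _ phi_inj S_phi]].
rewrite -(@card_imset (finvect_type F) _ phi predT phi_inj).
apply: eq_card => A; apply/idP/imsetP => [/S_phi[x <-]|[x _ ->]].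
  by exists x.
by apply/S_phi; exists x.
Qed.

Lemma card_rdiv_set (p n : nat) (D : {set 'M['F_p]_n}) (Y : 'M['F_p]_n) :
  Y \in unitmx -> #|rdiv_set D Y| = #|D|.
Proof.
by move=> Y_unit; apply: card_imset; apply: (can_inj (mulmxKV Y_unit)).
Qed.

Lemma unitmx_neq0 (R : comUnitRingType) (n : nat) (Y : 'M[R]_n.+1) :
  Y \in unitmx -> Y != 0.
Proof. by apply: contraTneq => ->; rewrite unitmxE det0 unitr0. Qed.

Lemma Quot_rdiv_set (p n : nat) (D : {set 'M['F_p]_n.+1}) Y :
  Y \in D -> Y \in unitmx ->
  {in D :\ 0, forall Z, rdiv_set D Z = rdiv_set D Y} ->
  Quot D = rdiv_set D Y.
Proof.
move=> DY Y_unit rdivE; apply/setP => A.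
apply/imset2P/imsetP => [[X Z DX]|[X DX ->]].
  rewrite inE => /andP[DZ Z_unit] ->; apply/imsetP.
  have DZ0 : Z \in D :\ 0 by rewrite in_setD1 unitmx_neq0.
  have : X *m invmx Z \in rdiv_set D Z by apply: imset_f.
  by rewrite (rdivE Z DZ0).
by exists X Y; rewrite ?inE ?DY.
Qed.

(** * The equivalences, by way of the square form *)

Section Equivalences.

Variables (p n : nat) (F : fieldExtType 'F_p).
Hypotheses (p_pr : prime p) (p_odd : odd p) (dimF : \dim {:F} = n.+1).
Variable e : n.+1.-tuple F.
Hypothesis e_basis : basis_of {:F} e.
Variable g : {poly F}.
Hypothesis gDO : DO_polynomial n.+1 g.

Let cv := coord_cv e.
Let cvD : {morph cv : x y / x + y} := coord_cvD e.
Let cv0 : cv 0 = 0 := morphD0 cvD.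
Let cv_inj : injective cv := coord_cv_inj e_basis.
Let cv_ext (A B : 'M['F_p]_n.+1) :
  (forall x, A *m cv x = B *m cv x) -> A = B := @mx_ext p n.+1 F e e_basis A B.
Let BDl := polarDl p_pr gDO.
Let BDr := polarDr p_pr gDO.

(** This is a strong isotopism between the product [polar g] and the multiplication of [F]: the same
    [sig] acts on both factors. *)
Definition square_form := exists lam sig : F -> F,
  [/\ {morph lam : x y / x + y}, bijective lam,
      {morph sig : x y / x + y}, bijective sig
    & forall x y, polar g x y = lam (sig x * sig y)].

(** The oddness of [p] enters here; it lets [polar g x x], which is twice [g.[x]], determine [g]. *)
Lemma mulr2n_inj : injective (fun x : F => x *+ 2).
Proof.
have two_neq0 : 2%:R != 0 :> F.
  rewrite -(dvdn_pcharf (pchar_fieldExt F p_pr)).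
  by rewrite dvdn_prime2 //; apply: contraTneq p_odd => ->.
move=> x y /=; rewrite -[x *+ 2]mulr_natr -[y *+ 2]mulr_natr.
exact: mulIf.
Qed.

Lemma M_E a : M_ e g a = mx_of e (polar g ^~ a).
Proof. by apply/matrixP => i j; rewrite !mxE horner_Delta. Qed.

Lemma M_cv a x : M_ e g a *m cv x = cv (polar g a x).
Proof. by rewrite M_E (mx_of_cv e_basis (BDl a)) /= polarC. Qed.

Lemma M_D : {morph M_ e g : x y / x + y}.
Proof.
move=> x y; apply: cv_ext => z.
by rewrite mulmxDl !M_cv BDl; apply: cvD.
Qed.

Lemma mem_D A : reflect (exists a, A = M_ e g a) (A \in D_ e g).
Proof. by apply: (iffP imsetP) => [[a _ ->]|[a ->]]; exists a. Qed.

Lemma mem_rdiv A Y :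
  reflect (exists a, A = M_ e g a *m invmx Y) (A \in rdiv_set (D_ e g) Y).
Proof.
apply: (iffP imsetP) => [[_ /mem_D[a ->] ->]|[a ->]]; first by exists a.
by exists (M_ e g a) => //; apply/mem_D; exists a.
Qed.

(** Since [M_ e g 1] sends [y] to [polar g 1 y], the action of a quotient is known on such values
    without computing an inverse. This is how the symmetry of [polar g] is brought to bear on
    products of quotients. *)
Lemma rdiv_polar A x y :
  M_ e g 1 \in unitmx -> A = M_ e g x *m invmx (M_ e g 1) ->
  A *m cv (polar g 1 y) = cv (polar g x y).
Proof. by move=> M1 ->; rewrite -M_cv mulmxA mulmxKV // M_cv. Qed.

(** Polarizing the equivalence removes its additive and constant terms and leaves [L'.[polar g L.[x]
    L.[y]] = x * y *+ 2]. Hence [sig] is the inverse of [L], and [lam] is doubling followed by the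
    inverse of [L']. *)
Lemma EA_square_form : EA_equivalent n.+1 g 'X^2 -> square_form.
Proof.
move=> [L [L' [L'' [u [v [w [[L_lin L_bij] [L'_lin L'_bij] L''_lin]]]]]]].
move/(eqp_modXq _ _ p_pr dimF) => eqX2.
have LD := linearizedD p_pr L_lin; have L'D := linearizedD p_pr L'_lin.
have L''D := linearizedD p_pr L''_lin.
have [sig LK sigK] := L_bij; have [mu L'K muK] := L'_bij.
have sigD := can_morphD LD LK sigK; have muD := can_morphD L'D L'K muK.
have eqX x : L'.[g.[L.[x] + u]] = x ^+ 2 - v - L''.[x] - w.
  have := eqX2 x; rewrite !hornerE !horner_comp !hornerE => ->; ring.
(* The translation by [u] drops out of the second difference because [polar g a] is additive. *)
have gu a b : g.[a + b + u] - g.[a + u] - g.[b + u] + g.[u] = polar g a b.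
  have := BDr a b u; rewrite {1 3}/polar addrA => gabu.
  have -> : g.[a + b + u] = polar g a b + (g.[a + u] - g.[a] - g.[u])
                            + g.[a] + g.[b + u] by rewrite -gabu; ring.
  ring.
have L'polar x y : L'.[polar g L.[x] L.[y]] = x * y *+ 2.
  rewrite -gu L'D !(morphDB L'D) -LD !eqX.
  have := eqX 0; rewrite (morphD0 LD) add0r => ->.
  rewrite L''D (morphD0 L''D); ring.
exists (fun z => mu (z *+ 2)), sig; split=> //.
- by move=> x y; rewrite mulrnDl muD.
- apply: inj_bij_fieldExt => x y /(can_inj muK).
  exact: mulr2n_inj.
- by exists (horner L).
by move=> x y; rewrite -L'polar L'K !sigK.
Qed.

(** Let [L] induce [tau], the inverse of [sig], and let [L'] induce [z] to [mu (z *+ 2)], with [mu]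
    the inverse of [lam]. Then [L'.[g.[L.[x]]] = mu (polar g (tau x) (tau x)) = x ^+ 2], with no
    translation or additive term. *)
Lemma square_form_EA : square_form -> EA_equivalent n.+1 g 'X^2.
Proof.
move=> [lam [sig [lamD [mu lamK muK] sigD [tau sigK tauK] gE]]].
have tauD := can_morphD sigD sigK tauK.
have muD := can_morphD lamD lamK muK.
have [L L_lin LE] := additive_linearized p_pr dimF e_basis tauD.
have mu2D : {morph (fun z => mu (z *+ 2)) : x y / x + y}.
  by move=> x y; rewrite mulrnDl muD.
have [L' L'_lin L'E] := additive_linearized p_pr dimF e_basis mu2D.
have L_bij : bijective (fun x => L.[x]).
  by apply: inj_bij_fieldExt => x y; rewrite !LE; apply: can_inj tauK _ _.
have L'_bij : bijective (fun x => L'.[x]).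
  apply: inj_bij_fieldExt => x y; rewrite !L'E => /(can_inj muK).
  exact: mulr2n_inj.
have lin0 : linearized (0 : {poly F}).
  by exists 0, (fun=> 0); rewrite big_ord0.
exists L, L', 0, 0, 0, 0; split=> //.
apply/(eqp_modXq _ _ p_pr dimF) => x.
rewrite !addr0 horner_comp horner_comp hornerXn LE L'E -(polar_diag p_pr gDO).
by rewrite gE lamK tauK.
Qed.

Lemma square_form_field : square_form ->
  M_ e g 1 \in unitmx /\ mx_isomorphic F (rdiv_set (D_ e g) (M_ e g 1)).
Proof.
move=> [lam [sig [lamD [mu lamK muK] sigD [tau sigK tauK] gE]]].
have muD := can_morphD lamD lamK muK.
have sig1 : sig 1 != 0.
  by rewrite -(morphD0 sigD) (can_eq sigK) oner_eq0.
have M1 : M_ e g 1 \in unitmx.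
  rewrite M_E; apply: (mx_of_unit e_basis (BDl 1)).
  apply: inj_bij_fieldExt => x y.
  by rewrite !gE => /(can_inj lamK) /(mulIf sig1) /(can_inj sigK).
split=> //; pose conj t z := lam (t * mu z).
have conjD t : {morph conj t : x y / x + y}.
  by move=> x y; rewrite /conj muD mulrDr lamD.
pose phi t := mx_of e (conj t).
have phi_cv t x : phi t *m cv x = cv (conj t x).
  exact: (mx_of_cv e_basis (conjD t)).
(* The index is the element [a] with [sig a / sig 1 = t]. *)
have phi_M t : phi t = M_ e g (tau (t * sig 1)) *m invmx (M_ e g 1).
  apply: (canRL (mulmxK M1)); apply: cv_ext => x.
  rewrite -mulmxA !M_cv phi_cv !gE /conj lamK tauK.
  by rewrite mulrA.
(* Evaluating at [lam 1] recovers the scalar: [conj t (lam 1) = lam t]. *)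
exists phi; split=> [x y|x y|x y /(congr1 (mulmx^~ (cv (lam 1))))|A].
- apply: cv_ext => z; rewrite mulmxDl !phi_cv.
  by rewrite /conj mulrDl lamD; apply: cvD.
- apply: cv_ext => z; rewrite -mulmxA !phi_cv.
  by rewrite /conj lamK mulrA.
- rewrite !phi_cv => /cv_inj; rewrite /conj lamK !mulr1.
  exact: can_inj lamK _ _.
split=> [/mem_rdiv[a ->]|[t <-]]; last first.
  by rewrite phi_M; apply/mem_rdiv; eexists.
by exists (sig a / sig 1); rewrite phi_M mulfVK // sigK.
Qed.

(** Take for [sig x] the field element representing the quotient of [M_ e g x] by [M_ e g 1], and
    for [lam z] the image of [c = polar g 1 1] under [phi z]. The orbit map [lam] is injective
    because [c] is nonzero and [phi] sends nonzero elements to invertible matrices. *)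
Lemma field_square_form :
  M_ e g 1 \in unitmx -> mx_isomorphic F (rdiv_set (D_ e g) (M_ e g 1)) ->
  square_form.
Proof.
move=> M1 [phi [phiD phiM phi_inj K_phi]].
have phi0 := morphD0 phiD.
have phi1 : phi 1 = 1%:M.
  apply: (mx_morph1 phiM); apply: (K_phi _).1.
  by apply/mem_rdiv; exists 1; rewrite mulmxV.
have /fin_all_exists[sig sigE] (x : finvect_type F) :
    exists t, phi t = M_ e g x *m invmx (M_ e g 1).
  by apply: (K_phi _).1; apply/mem_rdiv; exists x.
pose c := polar g 1 1.
have /fin_all_exists[lam lamE] (z : finvect_type F) :
    exists y, cv y = phi z *m cv c by apply: coord_cv_surj.
have c_neq0 : cv c != 0.
  rewrite -M_cv; apply: contraNneq (oner_neq0 F) => M1c.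
  apply/eqP/cv_inj.
  by rewrite -[LHS](mulKmx M1) M1c mulmx0 cv0.
have sigD : {morph sig : x y / x + y}.
  by move=> x y; apply: phi_inj; rewrite phiD !sigE M_D mulmxDl.
have lamD : {morph lam : x y / x + y}.
  move=> x y; apply: cv_inj.
  by rewrite cvD !lamE phiD mulmxDl.
have lam_inj : injective lam.
  move=> x y eq_xy; apply/eqP; rewrite -subr_eq0; apply: contraNT c_neq0.
  move=> xy_neq0; rewrite -[cv c]mul1mx -phi1 -(mulVf xy_neq0) phiM -mulmxA.
  by rewrite (morphDB phiD) mulmxBl -!lamE eq_xy subrr mulmx0.
(* The quotient of [y] sends [c] to [polar g y 1 = polar g 1 y], which the quotient of [x] sends to
   [polar g x y]. *)
have gE x y : polar g x y = lam (sig x * sig y).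
  apply: cv_inj; rewrite lamE phiM -mulmxA.
  rewrite (rdiv_polar 1 M1 (sigE y)) (polarC g y 1).
  by rewrite (rdiv_polar y M1 (sigE x)).
have sig_inj : injective sig.
  move=> x y eq_xy; apply/eqP; rewrite -subr_eq0; apply/eqP.
  apply: cv_inj; rewrite -[LHS](mulKmx M1).
  rewrite M_cv polarC (morphDB (BDl _)) !gE eq_xy subrr.
  by rewrite cv0 mulmx0.
by exists lam, sig; split=> //; apply: inj_bij_fieldExt.
Qed.

(** Here [D_ e g] consists of the matrices [phi x *m M_ e g 1]. The quotient of two of them is
    [phi (x / y)], so every set of quotients is the image of [phi]. *)
Lemma field_quotients :
  M_ e g 1 \in unitmx -> mx_isomorphic F (rdiv_set (D_ e g) (M_ e g 1)) ->
  [/\ forall X, X \in D_ e g :\ 0 -> X \in unitmx,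
      forall Y Z, Y \in D_ e g :\ 0 -> Z \in D_ e g :\ 0 ->
        rdiv_set (D_ e g) Y = rdiv_set (D_ e g) Z
    & #|Quot (D_ e g)| = (p ^ n.+1)%N].
Proof.
move=> M1 iso; have [phi [phiD phiM phi_inj K_phi]] := iso.
have D1 : M_ e g 1 \in D_ e g by apply/mem_D; exists 1.
have phi1 : phi 1 = 1%:M.
  apply: (mx_morph1 phiM); apply: (K_phi _).1.
  by apply/mem_rdiv; exists 1; rewrite mulmxV.
have D_phi X : X \in D_ e g <-> exists x, X = phi x *m M_ e g 1.
  split=> [DX|[x ->]].
    have [|x phi_x] := (K_phi (X *m invmx (M_ e g 1))).1; first exact: imset_f.
    by exists x; rewrite phi_x mulmxKV.
  have /imsetP[Z DZ ->] : phi x \in rdiv_set (D_ e g) (M_ e g 1).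
    by apply/K_phi; exists x.
  by rewrite mulmxKV.
have phi_unit x : x != 0 -> phi x \in unitmx.
  move=> x0; have phiV : phi x *m phi x^-1 = 1%:M by rewrite -phiM divff.
  exact: (proj1 (mulmx1_unit phiV)).
have D_neq0 x : phi x *m M_ e g 1 != 0 -> x != 0.
  by apply: contraNneq => ->; rewrite (morphD0 phiD) mul0mx.
have D_unit X : X \in D_ e g :\ 0 -> X \in unitmx.
  rewrite in_setD1 => /andP[X0 /D_phi[x eX]]; rewrite eX unitmx_mul M1 andbT.
  by apply: phi_unit; apply: D_neq0; rewrite -eX.
have rdivE Y : Y \in D_ e g :\ 0 ->
    rdiv_set (D_ e g) Y = rdiv_set (D_ e g) (M_ e g 1).
  move=> DY; have Y_unit := D_unit _ DY; move: DY.
  rewrite in_setD1 => /andP[Y0 /D_phi[y eY]].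
  have y0 : y != 0 by apply: D_neq0; rewrite -eY.
  have eYV X : X *m invmx Y = X *m invmx (M_ e g 1) *m phi y^-1.
    apply: (canLR (mulmxK Y_unit)); rewrite eY mulmxA -[_ *m _ *m phi y]mulmxA.
    by rewrite -phiM mulVf // phi1 mulmx1 mulmxKV.
  apply/setP => A; apply/imsetP/idP => [[_ /D_phi[x ->] ->]|/K_phi[t <-]].
    by apply/K_phi; exists (x / y); rewrite eYV mulmxK // phiM.
  exists (phi (t * y) *m M_ e g 1); first by apply/D_phi; eexists.
  by rewrite eYV mulmxK // -phiM mulfK.
split=> [//|Y Z DY DZ|]; first by rewrite !rdivE.
rewrite (Quot_rdiv_set D1 M1 rdivE) (card_mx_isomorphic iso).
exact: card_fieldExt.
Qed.

Lemma quotients_field :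
  [/\ forall X, X \in D_ e g :\ 0 -> X \in unitmx,
      forall Y Z, Y \in D_ e g :\ 0 -> Z \in D_ e g :\ 0 ->
        rdiv_set (D_ e g) Y = rdiv_set (D_ e g) Z
    & #|Quot (D_ e g)| = (p ^ n.+1)%N] ->
  M_ e g 1 \in unitmx /\ mx_isomorphic F (rdiv_set (D_ e g) (M_ e g 1)).
Proof.
move=> [D_unit rdivE cQ].
(* The cardinality excludes the zero set [D_ e g], for which the other two conditions hold
   vacuously. *)
have [Y [DY Y_unit]] : exists Y, Y \in D_ e g /\ Y \in unitmx.
  have : (0 < #|Quot (D_ e g)|)%N by rewrite cQ expn_gt0 prime_gt0.
  case/card_gt0P => A /imset2P[X Y _]; rewrite inE => /andP[DY Y_unit] _.
  by exists Y.
have DY0 : Y \in D_ e g :\ 0 by rewrite in_setD1 unitmx_neq0.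
have QE : Quot (D_ e g) = rdiv_set (D_ e g) Y.
  by apply: (Quot_rdiv_set DY Y_unit) => Z DZ; apply: (rdivE _ _ DZ DY0).
have cD : #|D_ e g| = (p ^ n.+1)%N by rewrite -cQ QE card_rdiv_set.
(* [D_ e g] is the image of [F] and has as many elements as [F]. Injectivity gives that [M_ e g 1]
   differs from [M_ e g 0 = 0]. *)
have M_inj : injective (M_ e g).
  have /eqP/imset_injP M_inj : #|D_ e g| = #|finvect_type F|.
    by rewrite cD (card_fieldExt p_pr dimF).
  by move=> x y; apply: M_inj.
have M0 : M_ e g 0 = 0 := morphD0 M_D.
have MB := morphDB M_D.
have D1 : M_ e g 1 \in D_ e g :\ 0.
  by rewrite in_setD1 -{1}M0 (inj_eq M_inj) oner_eq0; apply/mem_D; exists 1.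
have M1 := D_unit _ D1; split=> //.
set K := rdiv_set _ _.
have K_D A : A \in K -> A *m M_ e g 1 \in D_ e g.
  by case/imsetP=> X DX ->; rewrite mulmxKV.
have Kunit : {in K, forall A, A != 0 -> A \in unitmx}.
  move=> A KA A0; suff : A *m M_ e g 1 \in unitmx.
    by rewrite unitmx_mul M1 andbT.
  apply: D_unit; rewrite in_setD1 K_D // andbT.
  apply: contraNneq A0 => AM0; apply/eqP.
  by rewrite -[A](mulmxK M1) AM0 mul0mx.
have KB : zmod_closed K.
  split; first by apply/mem_rdiv; exists 0; rewrite M0 mul0mx.
  move=> _ _ /mem_rdiv[x ->] /mem_rdiv[y ->]; apply/mem_rdiv.
  by exists (x - y); rewrite MB mulmxBl.
(* For nonzero [B], the matrix [B *m M_ e g 1] is a nonzero element of [D_ e g], so [A] is also a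
   quotient by it. Multiplying by [B] on the right turns this into a quotient by [M_ e g 1]. *)
have KM : {in K &, forall A B, A *m B \in K}.
  move=> A B KA KB'; have [->|B0] := eqVneq B 0.
    by rewrite mulmx0; case: KB.
  have Z_unit : B *m M_ e g 1 \in unitmx by rewrite unitmx_mul M1 Kunit.
  have DZ : B *m M_ e g 1 \in D_ e g :\ 0.
    by rewrite in_setD1 K_D // unitmx_neq0.
  have : A \in rdiv_set (D_ e g) (B *m M_ e g 1) by rewrite -(rdivE _ _ D1 DZ).
  case/imsetP=> X DX ->.
  have -> : X *m invmx (B *m M_ e g 1) *m B = X *m invmx (M_ e g 1).
    by apply: (canRL (mulmxK M1)); rewrite -[LHS]mulmxA (mulmxKV Z_unit).
  exact: imset_f.
(* A nonzero commutator would be an invertible element of [K]. By symmetry it kills [polar g 1 1],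
   which would then be zero; but this is the image of [1] under the invertible [M_ e g 1]. *)
have KC : {in K &, forall A B, A *m B = B *m A}.
  move=> A B KA KB'; apply/eqP; rewrite -subr_eq0.
  apply: contraNT (oner_neq0 F) => AB0.
  have AB_unit : A *m B - B *m A \in unitmx.
    by apply: Kunit => //; case: KB => _ KB; rewrite KB ?KM.
  have kill : (A *m B - B *m A) *m cv (polar g 1 1) = 0.
    have [[a eA] [b eB]] := (mem_rdiv _ _ KA, mem_rdiv _ _ KB').
    rewrite mulmxBl -!mulmxA (rdiv_polar 1 M1 eA) (rdiv_polar 1 M1 eB).
    rewrite !(polarC g _ 1) (rdiv_polar b M1 eA) (rdiv_polar a M1 eB).
    by rewrite (polarC g b) subrr.
  apply/eqP/cv_inj; rewrite cv0 -[LHS](mulKmx M1) M_cv.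
  rewrite -[cv _](mulKmx AB_unit) kill.
  by rewrite !mulmx0.
apply: mx_field_isomorphic => //.
  by rewrite card_rdiv_set.
by apply/mem_rdiv; exists 1; rewrite mulmxV.
Qed.

End Equivalences.

Theorem theorem3 (p n : nat) (p_prime : prime p) (p_odd : odd p)
    (n_gt0 : (0 < n)%N) (F : fieldExtType 'F_p) (dimF : \dim {:F} = n)
    (e : n.-tuple F) (e_basis : basis_of {:F} e)
    (g : {poly F}) (gDO : DO_polynomial n g) :
  let D := D_ e g in
  let assertion1 := EA_equivalent n g 'X^2 in
  let assertion2 :=
    [/\ forall X, X \in D :\ 0 -> X \in unitmx,
        forall Y Z, Y \in D :\ 0 -> Z \in D :\ 0 -> rdiv_set D Y = rdiv_set D Z
      & #|Quot D| = (p ^ n)%N] in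
  let assertion3 :=
    M_ e g 1 \in unitmx /\
    (mx_field (rdiv_set D (M_ e g 1)) /\
     mx_isomorphic F (rdiv_set D (M_ e g 1))) in
  (assertion1 <-> assertion2) /\ (assertion2 <-> assertion3).
Proof.
case: n n_gt0 dimF e e_basis gDO => // m _ dimF' b b_basis gDO' D A1 A2 A3.
have A13 : A1 -> A3.
  move=> /(EA_square_form p_prime p_odd dimF' gDO') sq.
  have [M1 iso] := square_form_field p_prime b_basis gDO' sq.
  by split=> //; split=> //; apply: mx_isomorphic_mx_field iso.
have A31 : A3 -> A1.
  move=> [M1 [_ iso]]; apply: (square_form_EA p_prime p_odd dimF' b_basis gDO').
  exact: (field_square_form p_prime b_basis gDO' M1 iso).
have A32 : A3 -> A2.
  by move=> [M1 [_ iso]]; apply: (field_quotients p_prime dimF' M1 iso).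
have A23 : A2 -> A3.
  move=> /(quotients_field p_prime dimF' b_basis gDO')[M1 iso].
  by split=> //; split=> //; apply: mx_isomorphic_mx_field iso.
by split; [split=> [/A13/A32|/A23/A31]|].
Qed.
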